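(* The variety $\mathcal K$ is the greatest hereditarily finitely based subvariety of $\mathcal A$ and also the greatest hereditarily finitely based subvariety of $\mathcal M$. The hereditarily finitely based subvarieties of $\mathcal A$ and those of $\mathcal M$ form the same finite family.
   Context: An additively idempotent semiring (ai-semiring) is an algebra $(S,+,\cdot)$ of signature $(2,2)$, without constants, such that $(S,+)$ is a commutative idempotent semigroup, $(S,\cdot)$ is a semigroup, and multiplication distributes over addition. It is commutative if its multiplication is commutative. All varieties are in the signature $(2,2)$ and are ordered by inclusion. A variety is hereditarily finitely based if each of its subvarieties can be defined by finitely many identities. $\mathbf N$ is the ai-semiring on the nonnegative integers $\mathbb N_0$ whose semiring addition is $\max$ and whose semiring multiplication is numerical addition; $\mathcal M=\mathsf V(\mathbf N)$ is the variety it generates. $\mathcal A$ is the variety of commutative ai-semirings defined by $xy+x\approx xy$ and $x^2+y^2+xy\approx x^2+y^2$. $\mathcal K$ is the subvariety of $\mathcal A$ defined by $x_1x_2+x_2x_3+x_3x_4\approx x_1x_2+x_2x_3+x_3x_4+x_1x_4$. *)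

(* Defs.v *)
From mathcomp Require Import all_boot.
From mathcomp Require Import all_classical.

Set Implicit Arguments.
Unset Strict Implicit.
Unset Printing Implicit Defensive.

Local Open Scope classical_set_scope.

(* Algebras of signature (2,2), without constants. Following the usual        *)
(* convention of universal algebra, carriers are nonempty.                    *)
Record algebra := Algebra {
  carrier :> Type;
  aadd : carrier -> carrier -> carrier;
  amul : carrier -> carrier -> carrier;
  carrier_inhabited : inhabited carrier
}.

Record comm_ai_semiring (S : algebra) : Prop := CommAiSemiring {
  ai_addA : associative (@aadd S);
  ai_addC : commutative (@aadd S);
  ai_addxx : idempotent_op (@aadd S);
  ai_mulA : associative (@amul S);
  ai_mulC : commutative (@amul S);
  ai_mulDl : left_distributive (@amul S) (@aadd S);
  ai_mulDr : right_distributive (@amul S) (@aadd S)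
}.

Inductive term :=
| Var of nat
| TAdd of term & term
| TMul of term & term.

Definition identity := (term * term)%type.

Declare Scope term_scope.
Delimit Scope term_scope with term.
Bind Scope term_scope with term.
Notation "s + t" := (TAdd s t) : term_scope.
Notation "s * t" := (TMul s t) : term_scope.

Fixpoint eval (S : algebra) (v : nat -> S) (t : term) : S :=
  match t with
  | Var n => v n
  | TAdd s u => aadd (eval v s) (eval v u)
  | TMul s u => amul (eval v s) (eval v u)
  end.

Definition satisfies (S : algebra) (e : identity) : Prop :=
  forall v : nat -> S, eval v e.1 = eval v e.2.

Definition models (E : set identity) : set algebra :=
  [set S | forall e, E e -> satisfies S e].

Definition is_hom (S T : algebra) (f : S -> T) : Prop :=
  {morph f : x y / aadd x y} /\ {morph f : x y / amul x y}.

Lemma prod_inhabited (I : Type) (S : I -> algebra) :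
  inhabited (forall i, S i).
Proof.
have h i : exists x : S i, True by case: (carrier_inhabited (S i)) => x; exists x.
by constructor=> i; case: (cid (h i)).
Qed.

Definition prod_algebra (I : Type) (S : I -> algebra) : algebra :=
  @Algebra (forall i, S i)
    (fun x y i => aadd (x i) (y i)) (fun x y i => amul (x i) (y i))
    (prod_inhabited S).

(* Subalgebras are taken up to isomorphism, as embeddings; the product is     *)
(* over arbitrary, possibly empty, families.                                  *)
Record is_variety (V : set algebra) : Prop := IsVariety {
  variety_H : forall (S T : algebra) (f : S -> T),
    is_hom f -> (forall y, exists x, f x = y) -> V S -> V T;
  variety_S : forall (S T : algebra) (f : S -> T),
    is_hom f -> injective f -> V T -> V S;
  variety_P : forall (I : Type) (S : I -> algebra),
    (forall i, V (S i)) -> V (prod_algebra S)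
}.

Definition generated_variety (S : algebra) : set algebra :=
  [set T | forall V : set algebra, is_variety V -> V S -> V T].

Definition subvariety (W V : set algebra) : Prop := is_variety W /\ W `<=` V.

Definition finitely_based (V : set algebra) : Prop :=
  exists E : set identity, finite_set E /\ V = models E.

Definition hereditarily_finitely_based (V : set algebra) : Prop :=
  forall W : set algebra, subvariety W V -> finitely_based W.

Definition hfb_subvarieties (V : set algebra) : set (set algebra) :=
  [set W | subvariety W V /\ hereditarily_finitely_based W].

Definition is_greatest (F : set (set algebra)) (V : set algebra) : Prop :=
  F V /\ forall W, F W -> W `<=` V.

Definition algN : algebra := @Algebra nat maxn addn (inhabits 0).

Definition calM : set algebra := generated_variety algN.

Definition calA : set algebra :=
  let x := Var 0 in let y := Var 1 in
  [set S | comm_ai_semiring S] `&`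
  models [set (x * y + x, x * y)%term;
              (x * x + y * y + x * y, x * x + y * y)%term].

Definition calK : set algebra :=
  let x1 := Var 1 in let x2 := Var 2 in let x3 := Var 3 in let x4 := Var 4 in
  calA `&`
  models [set (x1 * x2 + x2 * x3 + x3 * x4,
               x1 * x2 + x2 * x3 + x3 * x4 + x1 * x4)%term].

(* Main.v *)
Require Import Defs.
From HB Require Import structures.
From mathcomp Require Import all_boot.
From mathcomp Require Import all_classical.
From mathcomp Require Import zify.

Set Implicit Arguments.
Unset Strict Implicit.
Unset Printing Implicit Defensive.

Local Open Scope classical_set_scope.

(** Write [a <= b] for [a + b = b]. An identity [p = q] says that each monomial of [q]
    is below [p] and conversely, so everything is about inequalities [w <= p] with
    [w] a monomial. In an algebra of A fix [t] and call [a], [b] adjacent when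
    [a b <= t]: this relation is symmetric, its loops form a clique, and [calK] is
    the class of algebras of A in which it is closed under walks of length three
    ([calKP]). Then its components are complete bipartite graphs or cliques of loops;
    moreover a product of three or more factors is below [t] exactly when the cubes
    of its factors are ([meval_le_cubes]).

    K lies in M ([calK_sub_calM]): if [w] is not below [t], the shape of the components
    yields nonnegative integer weights of the variables for which [w] is heavier than
    every monomial, up to a given degree, that is below [t] ([separation]). So an
    identity of N cannot fail in K, and Birkhoff's theorem ([birkhoff]) applies.

    K has finitely many subvarieties, all finitely based: an inequality between
    [p] and a monomial with at most two variables can be tested after folding
    each component onto one edge or one loop, and all components that do not
    contain these variables onto three in all ([walk_closed_retraction]). Eight
    variables therefore suffice, K is locally finite ([small_termP]), and a subvariety is
    determined by which of finitely many identities hold in it ([models_K_basis]).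

    Let an algebra of A be outside K. The monomials of a term of degree at most two
    form a graph on its variables. Sending the two colours of a bipartite term to
    suitable elements, and non-adjacent variables of different colours to the ends of
    a walk that does not close, one refutes all inequalities for bipartite terms
    except the trivial ones ([refutation]). So every subvariety of A outside K
    contains the models of the bipartite theory, the set of identities that is blind
    only to the differences between non-bipartite terms. That theory is not finitely
    based: the algebra of a long odd cycle satisfies its identities in few variables,
    since few vertices of the cycle induce a bipartite graph, but not all of them
    ([bipartite_not_finitely_based]). Hence the hereditarily finitely based
    subvarieties of A, and those of M, are exactly the subvarieties of K. *)

(** * Varieties and identities *)

HB.instance Definition _ := gen_eqMixin term.
HB.instance Definition _ := gen_choiceMixin term.

Definition identities_of (V : set algebra) : set identity :=
  [set e | forall S, V S -> satisfies S e].

Lemma eval_hom (S T : algebra) (f : S -> T) (v : nat -> S) p :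
  is_hom f -> eval (f \o v) p = f (eval v p).
Proof.
by case=> fD fM; elim: p => //= p -> q ->; rewrite ?fD ?fM.
Qed.

Lemma eval_prod (I : Type) (S : I -> algebra)
    (v : nat -> prod_algebra S) p i :
  (eval v p) i = eval (fun n => (v n) i) p.
Proof. by elim: p => //= p <- q <-. Qed.

Lemma models_variety E : is_variety (models E).
Proof.
split.
- move=> S T f fh fsurj SE e Ee w.
  have [v vE] := choice (fun n => fsurj (w n)).
  have -> : w = f \o v by apply/funext => n /=; rewrite vE.
  by rewrite !eval_hom // (SE e Ee v).
- move=> S T f fh finj TE e Ee v; apply: finj.
  by rewrite -!eval_hom // (TE e Ee).
- move=> I S SE e Ee v; apply: functional_extensionality_dep => i.
  by rewrite !eval_prod (SE i e Ee).
Qed.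

(** Terms over an arbitrary set of variables: the free algebra that maps onto
    [T] has to be generated by the elements of [T], which may be uncountably
    many. *)
Inductive gterm (X : Type) :=
| GVar of X
| GAdd of gterm X & gterm X
| GMul of gterm X & gterm X.

Fixpoint geval (X : Type) (S : algebra) (f : X -> S) (g : gterm X) : S :=
  match g with
  | GVar x => f x
  | GAdd a b => aadd (geval f a) (geval f b)
  | GMul a b => amul (geval f a) (geval f b)
  end.

Fixpoint grename (X : Type) (f : X -> nat) (g : gterm X) : term :=
  match g with
  | GVar x => Var (f x)
  | GAdd a b => TAdd (grename f a) (grename f b)
  | GMul a b => TMul (grename f a) (grename f b)
  end.

Fixpoint gvars (X : Type) (g : gterm X) : seq X :=
  match g with
  | GVar x => [:: x]
  | GAdd a b | GMul a b => gvars a ++ gvars b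
  end.

Lemma eval_grename (X : Type) (S : algebra) (f : X -> nat) (v : nat -> S) g :
  eval v (grename f g) = geval (v \o f) g.
Proof. by elim: g => //= a -> b ->. Qed.

Lemma geval_eq (X : Type) (S : algebra) (f f' : X -> S) g :
  (forall x, List.In x (gvars g) -> f x = f' x) -> geval f g = geval f' g.
Proof.
elim: g => /= [x|a IHa b IHb|a IHa b IHb] ff'; first by apply: ff'; left.
- by rewrite IHa ?IHb // => x xg; apply: ff'; apply/List.in_or_app; auto.
- by rewrite IHa ?IHb // => x xg; apply: ff'; apply/List.in_or_app; auto.
Qed.

Lemma number_variables (X : Type) (x0 : X) (s : seq X) :
  exists (f : X -> nat) (c : nat -> X), forall x, List.In x s -> c (f x) = x.
Proof.
elim: s => [|a s [f [c fc]]]; first by exists (fun=> 0), (fun=> x0).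
exists (fun x => if pselect (x = a) then 0 else (f x).+1).
exists (fun n => if n is k.+1 then c k else a) => x.
by case: pselect => [xa _|nxa] => [|[/esym//|/fc]]; rewrite ?xa.
Qed.

(** Two terms over [T] that agree in every algebra of the variety agree in
    any algebra satisfying its identities, since only finitely many elements
    of [T] occur in them. *)
Lemma identities_transfer (V : set algebra) (T : algebra) (a b : gterm T) :
  (forall e, identities_of V e -> satisfies T e) ->
  (forall (S : algebra) (f : T -> S), V S -> geval f a = geval f b) ->
  geval id a = geval id b.
Proof.
move=> TE ab.
have [x0] := carrier_inhabited T.
have [f [c fc]] := number_variables x0 (gvars a ++ gvars b).
have /TE/(_ c) : identities_of V (grename f a, grename f b).
  by move=> S VS v; rewrite !eval_grename; apply: ab.
rewrite !eval_grename /= => fab.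
rewrite (geval_eq (f' := c \o f)) ?fab; last first.
  by move=> x xa; rewrite /= fc //; apply/List.in_or_app; left.
by apply: geval_eq => x xb; rewrite /= fc //; apply/List.in_or_app; right.
Qed.

(** Birkhoff's theorem. The algebra [F] of term functions on a product
    of algebras of [V], with one factor refuting each pair of terms over [T] that
    some algebra of [V] refutes, is free in [V] over [T]; sending a term function
    to the value of its term is therefore a well-defined surjection [F -> T]. *)
Theorem birkhoff (V : set algebra) (T : algebra) :
  is_variety V -> (forall e, identities_of V e -> satisfies T e) -> V T.
Proof.
move=> VV TE.
pose refutes (ab : gterm T * gterm T) (Sf : {S : algebra & T -> S}) :=
  V (projT1 Sf) /\ geval (projT2 Sf) ab.1 <> geval (projT2 Sf) ab.2.
pose I := {ab | exists Sf, refutes ab Sf}.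
pose w (i : I) := projT1 (cid (projT2 i)).
have wP (i : I) : refutes (projT1 i) (w i) by exact: projT2 (cid (projT2 i)).
pose P := prod_algebra (fun i => projT1 (w i)).
have VP : V P by apply: (variety_P VV) => i; have [] := wP i.
pose gen (x : T) : P := fun i => projT2 (w i) x.
have gevalP g i : (geval gen g) i = geval (projT2 (w i)) g.
  by elim: g => //= a <- b <-.
have genP a b : geval gen a = geval gen b -> geval id a = geval id b.
  move=> gab; apply: (identities_transfer TE) => S f VS.
  apply: contrapT => fab.
  have iP : exists Sf, refutes (a, b) Sf by exists (existT _ S f).
  have [_ /=] := wP (exist _ (a, b) iP); apply.
  by rewrite -!(gevalP _ (exist _ (a, b) iP)) gab.
pose C := {x : P | exists g, geval gen g = x}.
have CD (x y : C) : exists g, geval gen g = aadd (projT1 x) (projT1 y).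
  by case: x y => x [a ax] [y [b bx]]; exists (GAdd a b) => /=; rewrite ax bx.
have CM (x y : C) : exists g, geval gen g = amul (projT1 x) (projT1 y).
  by case: x y => x [a ax] [y [b bx]]; exists (GMul a b) => /=; rewrite ax bx.
have C0 : inhabited C.
  have [x0] := carrier_inhabited T.
  by constructor; exists (gen x0), (GVar x0).
pose F := @Algebra C (fun x y => exist _ _ (CD x y))
                     (fun x y => exist _ _ (CM x y)) C0.
have VF : V F.
  apply: (variety_S VV (f := (fun x : F => projT1 x : P))) VP => //.
  by move=> [x xP] [y yP] /= xy; apply: eq_exist.
pose tm (x : C) := projT1 (cid (projT2 x)).
have tmP (x : C) : geval gen (tm x) = projT1 x.
  exact: projT2 (cid (projT2 x)).
apply: (variety_H VV (f := (fun x : F => geval id (tm x)))) VF.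
- by split=> x y /=; [apply: (genP _ (GAdd _ _))|apply: (genP _ (GMul _ _))];
    rewrite /= !tmP.
- move=> x; have xP : exists g, geval gen g = gen x by exists (GVar x).
  exists (exist _ (gen x) xP).
  by apply: (genP _ (GVar x)); rewrite tmP.
Qed.

(** * The order of an ai-semiring and monomials *)

Definition le (S : algebra) (a b : S) : Prop := aadd a b = b.
Arguments le {S} a b.

Local Notation "a <<= b" := (le a b) (at level 70, no associativity).
Local Notation "a ** b" := (amul a b) (at level 40, left associativity).

Section Order.
Variables (S : algebra) (HS : comm_ai_semiring S).
Implicit Types a b c t : S.

Lemma lexx a : a <<= a.
Proof. exact: ai_addxx. Qed.

Lemma le_trans a b c : a <<= b -> b <<= c -> a <<= c.
Proof. by rewrite /le => ab <-; rewrite (ai_addA HS) ab. Qed.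

Lemma le_anti a b : a <<= b -> b <<= a -> a = b.
Proof. by rewrite /le => ab ba; rewrite -ba (ai_addC HS) ab. Qed.

Lemma le_add a b t : aadd a b <<= t <-> a <<= t /\ b <<= t.
Proof.
split=> [abt|[at_ bt]]; last by rewrite /le -(ai_addA HS) bt.
split; apply: le_trans abt; rewrite /le (ai_addA HS) ?(ai_addxx HS) //.
by rewrite (ai_addC HS b) -(ai_addA HS) (ai_addxx HS).
Qed.

Lemma le_addl a b : a <<= aadd a b.
Proof. by have /le_add[] := lexx (aadd a b). Qed.

Lemma le_addr a b : b <<= aadd a b.
Proof. by have /le_add[] := lexx (aadd a b). Qed.

Lemma le_eq a b : (forall t, a <<= t <-> b <<= t) -> a = b.
Proof. by move=> ab; apply: le_anti; apply/ab; apply: lexx. Qed.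

Lemma mulAC a b c : a ** b ** c = a ** c ** b.
Proof. by rewrite -!(ai_mulA HS) (ai_mulC HS b). Qed.

Lemma mulCA a b c : a ** (b ** c) = b ** (a ** c).
Proof. by rewrite !(ai_mulA HS) (ai_mulC HS a). Qed.

End Order.

(** A monomial is a nonempty sequence of variables, with repetitions. *)
Fixpoint monomials (p : term) : seq (seq nat) :=
  match p with
  | Var n => [:: [:: n]]
  | TAdd p q => monomials p ++ monomials q
  | TMul p q => [seq a ++ b | a <- monomials p, b <- monomials q]
  end.

(** The term [Var 0] for the empty sequence is a junk value. *)
Fixpoint monomial_term (w : seq nat) : term :=
  match w with
  | [::] => Var 0
  | [:: x] => Var x
  | x :: w' => TMul (Var x) (monomial_term w')
  end.

Fixpoint sum_term (ws : seq (seq nat)) : term :=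
  match ws with
  | [::] => Var 0
  | [:: w] => monomial_term w
  | w :: ws' => TAdd (monomial_term w) (sum_term ws')
  end.

Definition meval (S : algebra) (v : nat -> S) (w : seq nat) : S :=
  eval v (monomial_term w).

Fixpoint variables (p : term) : seq nat :=
  match p with
  | Var n => [:: n]
  | TAdd p q | TMul p q => variables p ++ variables q
  end.

Lemma monomials_neq0 p w : w \in monomials p -> w != [::].
Proof.
elim: p w => [n|p IHp q IHq|p IHp q IHq] w /=.
- by rewrite inE => /eqP->.
- by rewrite mem_cat => /orP[/IHp|/IHq].
- by case/allpairsP=> -[a b] /= [/IHp + _ ->]; case: a.
Qed.

Lemma monomials_nonempty p : exists w, w \in monomials p.
Proof.
elim: p => [n|p [w wp] q _|p [a ap] q [b bq]] /=.
- by exists [:: n]; rewrite inE.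
- by exists w; rewrite mem_cat wp.
- by exists (a ++ b); apply/allpairsP; exists (a, b).
Qed.

Lemma monomials_variables p w x :
  w \in monomials p -> x \in w -> x \in variables p.
Proof.
elim: p w => [n|p IHp q IHq|p IHp q IHq] w /=.
- by rewrite inE => /eqP->.
- by rewrite !mem_cat => /orP[/IHp h /h ->|/IHq h /h ->]; rewrite ?orbT.
- case/allpairsP=> -[a b] /= [/IHp ap /IHq bq ->].
  by rewrite !mem_cat => /orP[/ap ->|/bq ->]; rewrite ?orbT.
Qed.

Lemma variables_monomials p x :
  x \in variables p -> exists2 w, w \in monomials p & x \in w.
Proof.
elim: p => [n|p IHp q IHq|p IHp q IHq] /=.
- by move=> xn; exists [:: n] => //; rewrite inE.
- rewrite mem_cat => /orP[/IHp|/IHq] [w wp xw];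
    by exists w; rewrite // mem_cat wp ?orbT.
- have [a ap] := monomials_nonempty p; have [b bq] := monomials_nonempty q.
  rewrite mem_cat => /orP[/IHp|/IHq] [w wp xw].
    by exists (w ++ b); [apply/allpairsP; exists (w, b)|rewrite mem_cat xw].
  exists (a ++ w); first by apply/allpairsP; exists (a, w).
  by rewrite mem_cat xw orbT.
Qed.

Lemma monomials_monomial_term w :
  w != [::] -> monomials (monomial_term w) = [:: w].
Proof. by elim: w => //= x [|y w] //= ->. Qed.

Lemma monomials_sum_term ws :
  ws != [::] -> {in ws, forall w, w != [::]} -> monomials (sum_term ws) = ws.
Proof.
elim: ws => //= w ws IH _ ws0.
have w0 : w != [::] by apply: ws0; rewrite inE eqxx.
case: ws IH ws0 => [|w' ws] IH ws0; first exact: monomials_monomial_term.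
rewrite /= monomials_monomial_term // -[monomials _]/(monomials (sum_term (w' :: ws))).
by rewrite IH // => u uws; apply: ws0; rewrite inE uws orbT.
Qed.

Lemma eval_ext (S : algebra) (v v' : nat -> S) p :
  {in variables p, v =1 v'} -> eval v p = eval v' p.
Proof.
elim: p => [n|p IHp q IHq|p IHp q IHq] /= vv'; first by rewrite vv' ?inE.
- by rewrite IHp ?IHq // => x xp; apply: vv'; rewrite mem_cat xp ?orbT.
- by rewrite IHp ?IHq // => x xp; apply: vv'; rewrite mem_cat xp ?orbT.
Qed.

Lemma variables_monomial_term w : w != [::] -> variables (monomial_term w) = w.
Proof. by elim: w => //= x [|y w] //= ->. Qed.

Lemma meval_ext (S : algebra) (v v' : nat -> S) w :
  w != [::] -> {in w, v =1 v'} -> meval v w = meval v' w.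
Proof. by move=> w0 vv'; apply: eval_ext; rewrite variables_monomial_term. Qed.

Section Monomials.
Variables (S : algebra) (HS : comm_ai_semiring S).
Implicit Types (a b c t : S) (v : nat -> S).

Lemma meval_cons v x w : w != [::] -> meval v (x :: w) = v x ** meval v w.
Proof. by case: w. Qed.

Lemma meval_cat v w w' :
  w != [::] -> w' != [::] -> meval v (w ++ w') = meval v w ** meval v w'.
Proof.
elim: w => // x [|y w] IH _ w'0; first by rewrite /= meval_cons.
rewrite cat_cons (@meval_cons v x ((y :: w) ++ w')) // IH //.
by rewrite (@meval_cons v x (y :: w)) // (ai_mulA HS).
Qed.

(** The induction goes through because it is stated under an arbitrary additive
    map [f]: for a product, [f] becomes multiplication by the other factor. *)
Lemma additive_le_monomials v p t (f : S -> S) :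
  {morph f : a b / aadd a b} ->
  f (eval v p) <<= t <-> forall w, w \in monomials p -> f (meval v w) <<= t.
Proof.
elim: p f => [n|p IHp q IHq|p IHp q IHq] f fD /=.
- by split=> [h w|h]; [rewrite inE => /eqP->|apply: (h [:: n]); rewrite inE].
- rewrite fD le_add // IHp // IHq //; split=> [[hp hq] w|h].
    by rewrite mem_cat => /orP[/hp|/hq].
  by split=> w wp; apply: h; rewrite mem_cat wp ?orbT.
- rewrite (IHp (fun a => f (a ** eval v q))); last first.
    by move=> a b; rewrite (ai_mulDl HS) fD.
  have fM a : f (a ** eval v q) <<= t <->
      forall w, w \in monomials q -> f (a ** meval v w) <<= t.
    by apply: (IHq (fun b => f (a ** b))) => b c; rewrite (ai_mulDr HS) fD.
  split=> [h w /allpairsP[[a b] /= [ap bq ->]]|h a ap].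
    rewrite meval_cat ?(monomials_neq0 ap) ?(monomials_neq0 bq) //.
    by move/fM: (h a ap); apply.
  apply/fM => b bq; rewrite -meval_cat ?(monomials_neq0 ap) ?(monomials_neq0 bq) //.
  by apply: h; apply/allpairsP; exists (a, b).
Qed.

Lemma le_monomials v p t :
  eval v p <<= t <-> forall w, w \in monomials p -> meval v w <<= t.
Proof. exact: (@additive_le_monomials v p t id). Qed.

Lemma le_sum_term v ws t : ws != [::] -> {in ws, forall w, w != [::]} ->
  eval v (sum_term ws) <<= t <-> forall w, w \in ws -> meval v w <<= t.
Proof. by move=> ws0 ws1; rewrite le_monomials monomials_sum_term. Qed.

End Monomials.

(** This lemma and the next reduce identities to inequalities [w <= p] with [w] a
    monomial. *)
Lemma monomial_identity (S : algebra) (HS : comm_ai_semiring S) p q w :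
  satisfies S (p, q) -> w \in monomials q ->
  satisfies S (TAdd (monomial_term w) p, p).
Proof.
move=> pq wq v; rewrite /= -/(meval v w) -/(le _ _).
by move/(le_monomials HS): (lexx HS (eval v q)) => /(_ w wq); rewrite -(pq v).
Qed.

Lemma le_of_identities (S : algebra) (HS : comm_ai_semiring S) p q :
  (forall (v : nat -> S) w, w \in monomials q -> meval v w <<= eval v p) ->
  (forall (v : nat -> S) w, w \in monomials p -> meval v w <<= eval v q) ->
  satisfies S (p, q).
Proof.
move=> qp pq v; apply: (le_anti HS); apply/(le_monomials HS) => w.
  exact: pq.
exact: qp.
Qed.

(** * The varieties A and K *)

(** Quantifying over an upper bound [t] turns the identities into closure properties
    of the relation [edge t] introduced below: here, its loops form a clique. *)
Record A_laws (S : algebra) : Prop := ALaws {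
  A_ai : comm_ai_semiring S;
  A_mul : forall a b : S, a <<= a ** b;
  A_clique : forall a b t : S, a ** a <<= t -> b ** b <<= t -> a ** b <<= t
}.

Lemma calAP (S : algebra) : calA S <-> A_laws S.
Proof.
split=> [[HS SA]|[HS SM SC]].
  split=> // [a b|a b t aa bb].
    have /SA/(_ (fun n => if n is 0 then a else b)) /= :
        [set (Var 0 * Var 1 + Var 0, Var 0 * Var 1)%term;
             (Var 0 * Var 0 + Var 1 * Var 1 + Var 0 * Var 1,
              Var 0 * Var 0 + Var 1 * Var 1)%term]
         (Var 0 * Var 1 + Var 0, Var 0 * Var 1)%term by left.
    by rewrite (ai_addC HS).
  have /SA/(_ (fun n => if n is 0 then a else b)) /= :
      [set (Var 0 * Var 1 + Var 0, Var 0 * Var 1)%term;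
           (Var 0 * Var 0 + Var 1 * Var 1 + Var 0 * Var 1,
            Var 0 * Var 0 + Var 1 * Var 1)%term]
       (Var 0 * Var 0 + Var 1 * Var 1 + Var 0 * Var 1,
        Var 0 * Var 0 + Var 1 * Var 1)%term by right.
  rewrite (ai_addC HS) => h; apply: (le_trans HS h); exact/(le_add HS).
split=> // e [->|->] v /=; first by rewrite (ai_addC HS); apply: SM.
rewrite (ai_addC HS); apply: SC; [exact: le_addl|exact: le_addr].
Qed.

Definition edge (S : algebra) (t a b : S) : Prop := a ** b <<= t.

(** The defining identity of [calK], read against upper bounds. *)
Definition walk_closed (S : algebra) : Prop := forall t a b c d : S,
  edge t a b -> edge t b c -> edge t c d -> edge t a d.

Lemma calKP (S : algebra) : calK S <-> A_laws S /\ walk_closed S.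
Proof.
rewrite -calAP; split=> -[SA SK]; split=> //; have HS := A_ai ((calAP S).1 SA).
  move=> t a b c d ab bc cd.
  have /(_ (fun n => match n with 1 => a | 2 => b | 3 => c | _ => d end)) /= :=
    SK _ erefl.
  move=> h; apply: (@le_trans _ HS _ (aadd (aadd (a ** b) (b ** c)) (c ** d))).
    by rewrite h; apply: le_addr.
  by rewrite !le_add.
move=> e -> v /=; symmetry; rewrite (ai_addC HS).
have := lexx HS (aadd (aadd (v 1 ** v 2) (v 2 ** v 3)) (v 3 ** v 4)).
rewrite {1}le_add // {1}le_add // => -[[h1 h2] h3].
exact: SK h1 h2 h3.
Qed.

Section KLaws.
Variables (S : algebra) (SA : A_laws S) (SK : walk_closed S).
Implicit Types a b c t : S.
Let HS := A_ai SA.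

Lemma edgeC t a b : edge t a b -> edge t b a.
Proof. by rewrite /edge (ai_mulC HS). Qed.

Lemma edge_le t a b : edge t a b -> a <<= t.
Proof. exact: (le_trans HS (A_mul SA a b)). Qed.

Lemma triangle_loop t a b c : edge t a b -> edge t b c -> edge t c a -> edge t a a.
Proof. exact: SK. Qed.

Definition cube_le t a : Prop := a ** a ** a <<= t.

Lemma triple_edge t a b c : a ** b ** c <<= t -> edge t a b.
Proof. exact: (le_trans HS (A_mul SA _ c)). Qed.

(** The walk [a b], [c], [a], [b c]. *)
Lemma double_middle t a b c : a ** b ** c <<= t -> a ** (b ** b) ** c <<= t.
Proof.
move=> abc; have : edge t (a ** b) (b ** c).
  apply: (SK (b := c) (c := a)) => //.
    by rewrite /edge (ai_mulC HS); apply: (@triple_edge t _ _ b); rewrite (mulAC HS).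
  by rewrite /edge (ai_mulA HS).
by rewrite /edge !(ai_mulA HS).
Qed.

Lemma triple_cube t a b c : a ** b ** c <<= t -> cube_le t a.
Proof.
rewrite (ai_mulC HS a) => /double_middle/double_middle h.
apply: (@le_trans _ HS _ (a ** a ** a ** (a ** (b ** c)))); first exact: A_mul.
by move: h; rewrite (ai_mulC HS b) -!(ai_mulA HS).
Qed.

Lemma cube_square t a : cube_le t a -> edge t a a.
Proof. exact: triple_edge. Qed.

Lemma cube_sixth t a : cube_le t a -> edge t (a ** a ** a) (a ** a ** a).
Proof.
move=> /double_middle/double_middle h.
by move: h; rewrite /edge !(ai_mulA HS).
Qed.

Lemma cube_mul t a b : cube_le t a -> cube_le t b -> cube_le t (a ** b).
Proof.
move=> /cube_sixth a6 /cube_sixth b6; have := A_clique SA a6 b6.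
rewrite /cube_le; congr (_ <<= _).
by rewrite -!(ai_mulA HS) !(mulCA HS b a).
Qed.

Lemma loop_cube t a b : edge t a a -> cube_le t b -> cube_le t a.
Proof.
move=> aa b3; apply: (@triple_cube t a b b).
rewrite -(ai_mulA HS); apply: (A_clique SA aa).
apply: (@edge_le t _ (b ** b)); rewrite /edge.
by move/cube_sixth: b3; rewrite /edge !(ai_mulA HS).
Qed.

End KLaws.

(** ** Equational bases of A and K *)

Definition ai_identities : seq identity :=
  let x := Var 0 in let y := Var 1 in let z := Var 2 in
  [:: (x + (y + z), x + y + z)%term; (x + y, y + x)%term; (x + x, x)%term;
      (x * (y * z), x * y * z)%term; (x * y, y * x)%term;
      ((x + y) * z, x * z + y * z)%term; (x * (y + z), x * y + x * z)%term].

Definition A_identities : seq identity :=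
  let x := Var 0 in let y := Var 1 in
  [:: (x * y + x, x * y)%term;
      (x * x + y * y + x * y, x * x + y * y)%term] ++ ai_identities.

Definition K_identities : seq identity :=
  let x1 := Var 1 in let x2 := Var 2 in let x3 := Var 3 in let x4 := Var 4 in
  (x1 * x2 + x2 * x3 + x3 * x4,
   x1 * x2 + x2 * x3 + x3 * x4 + x1 * x4)%term :: A_identities.

Lemma models_cons (e : identity) (s : seq identity) (S : algebra) :
  models [set` e :: s] S <-> satisfies S e /\ models [set` s] S.
Proof.
split=> [Ses|[Se Ss] e'].
  split=> [|e' e's]; apply: Ses; rewrite /= inE ?eqxx //.
  by move: e's => /= ->; rewrite orbT.
by rewrite /= inE => /orP[/eqP->|/Ss].
Qed.

Definition env3 (S : algebra) (a b c : S) (n : nat) : S :=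
  match n with 0 => a | 1 => b | _ => c end.

Lemma models_ai_identities (S : algebra) :
  models [set` ai_identities] S <-> comm_ai_semiring S.
Proof.
rewrite !models_cons; split=> [[h1 [h2 [h3 [h4 [h5 [h6 [h7 _]]]]]]]|HS].
  split=> [a b c|a b|a|a b c|a b|a b c|a b c].
  - exact: (h1 (env3 a b c)).
  - exact: (h2 (env3 a b b)).
  - exact: (h3 (env3 a a a)).
  - exact: (h4 (env3 a b c)).
  - exact: (h5 (env3 a b b)).
  - exact: (h6 (env3 a b c)).
  - exact: (h7 (env3 a b c)).
case: HS => h1 h2 h3 h4 h5 h6 h7.
split=> [v|]; first exact: h1.
split=> [v|]; first exact: h2.
split=> [v|]; first exact: h3.
split=> [v|]; first exact: h4.
split=> [v|]; first exact: h5.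
split=> [v|]; first exact: h6.
by split=> [v|//]; first exact: h7.
Qed.

Lemma models_A_identities : models [set` A_identities] = calA.
Proof.
apply/seteqP; split=> S.
  rewrite 2!models_cons => -[h1 [h2]]; rewrite models_ai_identities => HS.
  by split=> // e [->|->].
by case=> HS SA; rewrite 2!models_cons models_ai_identities; split; [|split=> //];
  apply: SA; [left|right].
Qed.

Lemma models_K_identities : models [set` K_identities] = calK.
Proof.
apply/seteqP; split=> S; rewrite models_cons models_A_identities.
  by case=> SK SA; split=> // e ->.
by case=> SA SK; split=> //; apply: SK.
Qed.

Lemma calA_variety : is_variety calA.
Proof. by rewrite -models_A_identities; apply: models_variety. Qed.

Lemma calK_variety : is_variety calK.
Proof. by rewrite -models_K_identities; apply: models_variety. Qed.

Lemma calK_sub_calA : calK `<=` calA.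
Proof. by move=> S []. Qed.

Lemma le_algN (a b : nat) : le (a : algN) b <-> a <= b.
Proof. by rewrite /le /=; split; lia. Qed.

Lemma algN_A : A_laws algN.
Proof.
split; last 2 first.
- by move=> a b; apply/le_algN => /=; lia.
- by move=> a b t /le_algN/= aa /le_algN/= bb; apply/le_algN => /=; lia.
split=> /=.
- exact: maxnA.
- exact: maxnC.
- exact: maxnn.
- exact: addnA.
- exact: addnC.
- exact: addn_maxl.
- exact: addn_maxr.
Qed.

Lemma calM_sub_calA : calM `<=` calA.
Proof. by move=> S; apply; [exact: calA_variety|apply/calAP; exact: algN_A]. Qed.

Lemma identities_calM (S : algebra) :
  (forall e, satisfies algN e -> satisfies S e) -> calM S.
Proof. by move=> SN V VV VN; apply: birkhoff => // e Ve; apply/SN/Ve. Qed.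

(** * Monomials in algebras of K *)

Section KMonomials.
Variables (S : algebra) (SA : A_laws S).
Implicit Types (a b c t : S) (v : nat -> S).
Let HS := A_ai SA.

Lemma meval_var_le v w t x : x \in w -> meval v w <<= t -> v x <<= t.
Proof.
elim: w t => // y [|z w] IH t; first by rewrite inE => /eqP->.
rewrite inE meval_cons // => /orP[/eqP->|xw]; first exact: (le_trans HS (A_mul SA _ _)).
rewrite (ai_mulC HS) => h; apply: IH xw _; apply: (le_trans HS (A_mul SA _ _) h).
Qed.

Lemma meval_split v w x : x \in w -> 1 < size w ->
  exists b, meval v w = v x ** b.
Proof.
elim: w => // y [|z w] IH //; rewrite inE meval_cons // => /orP[/eqP->|xw] _.
  by exists (meval v (z :: w)).
case: w IH xw => [|z' w] IH xw.
  by exists (v y); rewrite (ai_mulC HS); move: xw; rewrite inE => /eqP->.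
by have [b ->] := IH xw isT; exists (v y ** b); rewrite (mulCA HS).
Qed.

Lemma meval_split3 v w x : x \in w -> 2 < size w ->
  exists b c, meval v w = v x ** b ** c.
Proof.
case: w => // y [|z [|z' w]] //; rewrite inE meval_cons // => /orP[/eqP->|xw] _.
  by exists (v z), (meval v (z' :: w)); rewrite meval_cons // (ai_mulA HS).
by have [b ->] := meval_split v xw isT; exists (v y), b;
  rewrite (mulCA HS) (ai_mulA HS).
Qed.

Hypothesis SK : walk_closed S.

(** A monomial of degree at least three only remembers which variables occur. *)
Lemma meval_le_cubes v w t : 2 < size w ->
  meval v w <<= t <-> forall x, x \in w -> cube_le t (v x).
Proof.
move=> w3; split=> [wt x xw|wt].
  by have [b [c E]] := meval_split3 v xw w3; move: wt; rewrite E;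
    move/(triple_cube SA SK).
have w0 : w != [::] by case: w w3 {wt}.
suff: cube_le t (meval v w) by move/(cube_square SA)/(edge_le SA).
elim: w {w3} w0 wt => // x [|y w] IH _ wt; first by apply: (wt x); rewrite inE.
rewrite meval_cons //; apply: (cube_mul SA SK).
  by apply: (wt x); rewrite inE eqxx.
by apply: IH => // z zw; apply: wt; rewrite inE zw orbT.
Qed.

End KMonomials.

Lemma meval_algN (h : nat -> nat) w :
  w != [::] -> meval (h : nat -> algN) w = sumn (map h w).
Proof.
elim: w => // x [|y w] IH _; first by rewrite /= addn0.
by rewrite meval_cons // IH.
Qed.

Lemma sumn_count (P : pred nat) w : sumn (map (fun z => P z : nat) w) = count P w.
Proof. by elim: w => //= x w ->. Qed.

Lemma sumn_bounded (h : nat -> nat) D w : {in w, forall z, h z <= D} ->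
  sumn (map h w) <= size w * D.
Proof.
elim: w => // x w IH hw; rewrite /= mulSn leq_add ?hw ?inE ?eqxx ?IH // => z zw.
by apply: hw; rewrite inE zw orbT.
Qed.

(** * Walk-closed relations *)

Section WalkClosed.
Variable e : nat -> nat -> Prop.
Hypothesis eC : forall a b, e a b -> e b a.
Hypothesis eW : forall a b c d, e a b -> e b c -> e c d -> e a d.

(** In a symmetric relation closed under walks of length three every component is a
    complete bipartite graph or a clique of loops; for [x] without a loop these are
    the vertices on the side of [x]. *)
Definition same_side (x z : nat) : Prop := z = x \/ exists2 b, e x b & e z b.

Lemma same_side_edge x y z z' :
  same_side x z -> same_side y z' -> e z z' -> e x y.
Proof.
move=> xz yz' zz'; have {xz} xz' : e x z'.
  by case: xz => [<-//|[b xb zb]]; apply: eW xb (eC zb) zz'.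
by case: yz' => [<-//|[b yb z'b]]; apply: eW xz' z'b (eC yb).
Qed.

End WalkClosed.

(** * K is contained in M *)

Section Separation.
Variables (S : algebra) (SA : A_laws S) (SK : walk_closed S).
Variables (v : nat -> S) (t : S) (D : nat).
Let HS := A_ai SA.
Let e (x y : nat) := edge t (v x) (v y).

(** A weight function on the variables, read as a valuation in [algN], refutes [w <= p]
    when [w] weighs more than every monomial of [p]. *)
Definition separable (m : seq nat) : Prop := exists (h : nat -> nat) T,
  (forall w, w != [::] -> size w <= D.+1 -> meval v w <<= t ->
     sumn (map h w) <= T) /\
  T < sumn (map h m).

Let eC x y : e x y -> e y x. Proof. exact: (edgeC SA). Qed.

Lemma edge_monomial x y : meval v [:: x; y] <<= t -> e x y.
Proof. by []. Qed.

Lemma long_monomial_loop w z : 2 < size w -> meval v w <<= t -> z \in w -> e z z.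
Proof.
by move=> w3 /(meval_le_cubes SA SK _ _ w3) wt /wt; apply: (cube_square SA).
Qed.

Let eW a b c d : e a b -> e b c -> e c d -> e a d.
Proof. exact: SK. Qed.

Lemma separable_missing m x : x \in m -> ~ v x <<= t -> separable m.
Proof.
move=> xm xt; exists (fun z => (z == x) : nat), 0; split=> [w w0 _ wt|].
  rewrite sumn_count leqn0 -leqn0 leqNgt -has_count; apply/hasP => -[z zw /eqP zx].
  by apply: xt; rewrite -zx; apply: (meval_var_le SA zw wt).
by rewrite sumn_count -has_count; apply/hasP; exists x.
Qed.

(** Weight one on the sides of [x] and [y]: no two of these variables, equal or
    not, are adjacent, so they occur at most once in a monomial below [t]. *)
Lemma separable_nonloops x y m :
  ~ e x x -> ~ e y y -> ~ e x y -> separable (x :: y :: m).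
Proof.
move=> xx yy xy.
pose P z := `[< same_side e x z \/ same_side e y z >].
have PP z z' : P z -> P z' -> ~ e z z'.
  move=> /asboolP[] h /asboolP[] h' /(same_side_edge eC eW h h') //.
  by move/eC.
exists (fun z => P z : nat), 1; split=> [w w0 _ wt|]; last first.
  have Px : P x by apply/asboolP; left; left.
  have Py : P y by apply/asboolP; right; left.
  by rewrite /= Px Py.
rewrite sumn_count; case: w w0 wt => // a [|b [|c w]] _ wt /=; first by case: (P a).
  case: (boolP (P a)) => // Pa; case: (boolP (P b)) => // Pb.
  by case: (PP _ _ Pa Pb); apply: edge_monomial.
rewrite -[X in X <= _]/(count P (a :: b :: c :: w)) leqW // leqn0 -leqn0.
rewrite leqNgt -has_count; apply/hasP => -[z zw Pz].
by apply: (PP _ _ Pz Pz); apply: long_monomial_loop zw.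
Qed.

(** The side of [y] gets the weight of a whole monomial, so that [x], with
    weight one, tips the scales. *)
Lemma separable_loop x y m :
  e x x -> ~ e y y -> ~ e x y -> separable (x :: y :: m).
Proof.
move=> xx yy xy.
pose P z := `[< same_side e y z >].
pose h z := if P z then D.+1 else (z == x : nat).
have PP z z' : P z -> P z' -> ~ e z z'.
  by move=> /asboolP h1 /asboolP h2 /(same_side_edge eC eW h1 h2).
have Px z : P z -> ~ e z x.
  by move=> /asboolP h1 /(same_side_edge eC eW h1 (or_introl erefl))/eC.
have PxF : P x = false by apply/negP => /Px; apply.
have hP z : ~~ P z -> h z <= 1 by rewrite /h => /negPf->; case: eqP.
have hN z z' : P z -> e z z' -> h z' = 0.
  rewrite /h => Pz zz'; case: (boolP (P z')) => [/(PP _ _ Pz)//|_].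
  by case: eqP => // z'x; case: (Px _ Pz); rewrite -z'x.
exists h, D.+1; split=> [w w0 wD wt|]; last first.
  have Py : P y by apply/asboolP; left.
  by rewrite /= {1}/h PxF eqxx /h Py; lia.
have [/hasP[z zw Pz]|/hasPn wP] := boolP (has P w); last first.
  apply: leq_trans (sumn_bounded (D := 1) _) _; last by rewrite muln1.
  by move=> z /wP/hP.
case: w w0 wt zw {wD} => // a [|b [|c w]] _ wt zw.
- by rewrite /= addn0 /h; case: ifP => // _; case: (a == x).
- have ab := edge_monomial wt.
  move: zw; rewrite /= addn0 !inE => /orP[] /eqP zE; rewrite zE in Pz.
    by rewrite (hN _ _ Pz ab) addn0 /h Pz.
  by rewrite (hN _ _ Pz (eC ab)) add0n /h Pz.
- by case: (PP _ _ Pz Pz); apply: long_monomial_loop zw.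
Qed.

Lemma separable_perm m m' : perm_eq m m' -> separable m' -> separable m.
Proof.
move=> mm' [h [T [hw hm]]]; exists h, T; split=> //.
by rewrite (perm_sumn (perm_map h mm')).
Qed.

Lemma separable_nonedge x y m : ~ e x y -> separable (x :: y :: m).
Proof.
move=> xy; have [xx|xx] := pselect (e x x); have [yy|yy] := pselect (e y y).
- by case: xy; apply: (A_clique SA).
- exact: separable_loop.
- apply: (@separable_perm _ (y :: x :: m)).
    by rewrite -![_ :: _ :: m]/([:: _; _] ++ m) perm_cat2r (perm_catC [:: x] [:: y]).
  by apply: separable_loop => // /eC.
- exact: separable_nonloops.
Qed.

(** If [m] has two or more factors and all pairs of them are adjacent, then there are
    at least three, all loops, and one of them has its cube not below [t]. By [loop_cube] no
    monomial of degree three or more is then below [t], and weight one on all loops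
    separates. *)
Lemma separation m : m != [::] -> ~ meval v m <<= t -> separable m.
Proof.
move=> m0 mt; apply: contrapT => nsep.
have m_edge m' x y : perm_eq m (x :: y :: m') -> e x y.
  move=> mP; apply: contrapT => /(@separable_nonedge _ _ m').
  by move/(separable_perm mP).
case: m m0 mt nsep m_edge => // a [|b [|c m]] _ mt nsep m_edge.
- by apply: nsep; apply: (separable_missing _ mt); rewrite inE.
- by apply: mt; apply: (m_edge [::] a b).
have {m_edge} loop x : x \in [:: a, b, c & m] -> e x x.
  move=> /perm_to_rem; set m' := rem _ _ => mP.
  have : size m' = (size m).+2 by move/perm_size: mP => /= [].
  case: m' mP => // y [|z m'] // mP _.
  apply: (triangle_loop SK (b := v y) (c := v z)).
  - exact: m_edge mP.
  - apply: (m_edge (x :: m')); apply: perm_trans mP _.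
    by apply/permP => P /=; lia.
  - apply: eC; apply: (m_edge (y :: m')); apply: perm_trans mP _.
    by apply/permP => P /=; lia.
have [x xm x3] : exists2 x, x \in [:: a, b, c & m] & ~ cube_le t (v x).
  apply: contrapT => nx; apply: mt; apply/(meval_le_cubes SA SK) => // x xm.
  by apply: contrapT => x3; apply: nx; exists x.
pose P z := `[< e z z >].
apply: nsep; exists (fun z => P z : nat), 2; split=> [w w0 _ wt|]; last first.
  by rewrite sumn_count (@eq_in_count _ P predT) ?count_predT // => z /loop/asboolP.
rewrite sumn_count; have [w2|w3] := leqP (size w) 2.
  exact: leq_trans (count_size _ _) w2.
case: w {w0} wt w3 => // z w wt w3; case: x3; apply: (loop_cube SA SK (b := v z)).
  exact: loop.
by move/(meval_le_cubes SA SK): wt; apply; rewrite ?inE ?eqxx.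
Qed.

End Separation.

Lemma calK_sub_calM : calK `<=` calM.
Proof.
move=> S /calKP[SA SK]; have HS := A_ai SA.
have NS p q (v : nat -> S) w :
    satisfies algN (p, q) -> w \in monomials q -> meval v w <<= eval v p.
  move=> pq wq; apply: contrapT => wp.
  pose D := \max_(u <- monomials p) size u.
  have [h [T [hp hw]]] := separation SA SK D (monomials_neq0 wq) wp.
  have/(le_algN _ T) : le (eval (h : nat -> algN) q) T.
    rewrite -(pq h); apply/(le_monomials (A_ai algN_A)) => u up.
    have u0 := monomials_neq0 up.
    rewrite le_algN meval_algN //; apply: hp => //.
      by rewrite leqW // /D (big_rem u) //= leq_maxl.
    by move/(le_monomials HS): (lexx HS (eval v p)); apply.
  move/le_algN/(le_monomials (A_ai algN_A))/(_ w wq).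
  by rewrite le_algN meval_algN ?(monomials_neq0 wq) // leqNgt hw.
apply: identities_calM => -[p q] pq.
by apply: (le_of_identities HS) => v w; apply: NS => // u; rewrite pq.
Qed.

(** * Subvarieties of K *)

Section Retraction.
Variable e : nat -> nat -> Prop.
Hypothesis eC : forall a b, e a b -> e b a.
Hypothesis eW : forall a b c d, e a b -> e b c -> e c d -> e a d.
Hypothesis e_clique : forall a b, e a a -> e b b -> e a b.
Variables x y : nat.

Let neighbour (z : nat) : nat := xget 0 [set b | e z b].

Let neighbourP z b : e z b -> e z (neighbour z).
Proof. by move=> zb; apply: (@xgetPex _ 0 [set b | e z b]); exists b. Qed.

Let neighbour_eq a b c : e a b -> e a c -> neighbour b = neighbour c.
Proof.
move=> ab ac; congr (xget _ _); apply/seteqP; split=> d /= h.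
  exact: eW (eC ac) ab h.
exact: eW (eC ab) ac h.
Qed.

Let loop_neighbour a b : e a a -> e a b -> e b b.
Proof. by move=> aa ab; apply: eW (eC ab) aa ab. Qed.

(** Canonical neighbours of the two sides of a bipartite component tell the sides
    apart. *)
Let colour (z : nat) : bool := neighbour z < neighbour (neighbour z).

Let colour_edge a b : e a b -> ~ e a a -> colour b = ~~ colour a.
Proof.
move=> ab aa; have ba := eC ab.
rewrite /colour (neighbour_eq (neighbourP ab) ab).
rewrite (neighbour_eq (neighbourP ba) ba).
have : neighbour a <> neighbour b.
  move=> ab_eq; apply: aa; apply: (eW ab (neighbourP ba)).
  by rewrite -ab_eq; apply/eC/(neighbourP ab).
by move=> h; lia.
Qed.

Let loop_vertex : nat := xget 0 [set c | e c c].
Let edge_pair : nat * nat := xget (0, 0) [set c | e c.1 c.2].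

Let index (z : nat) : nat :=
  if z == x then 0 else if z == y then 1
  else if `[< e z z >] then 2
  else if `[< same_side e x z >] then 0 else if `[< e x z >] then 3
  else if `[< same_side e y z >] then 1 else if `[< e y z >] then 4
  else if `[< exists b, e z b >] then (if colour z then 5 else 6)
  else 7.

Let vertex (k : nat) : nat :=
  match k with
  | 0 => x | 1 => y | 2 => loop_vertex | 3 => neighbour x | 4 => neighbour y
  | 5 => edge_pair.1 | 6 => edge_pair.2 | _ => 0
  end.

Let f z := vertex (index z).

Let f_x : f x = x.
Proof. by rewrite /f /index eqxx. Qed.

Let f_y : f y = y.
Proof. by rewrite /f /index eqxx; case: (y =P x) => [->|]. Qed.

Let f_loop z : e z z -> e (f z) (f z).
Proof.
move=> zz; have [zx|zx] := eqVneq z x; first by rewrite zx f_x -zx.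
have [zy|zy] := eqVneq z y; first by rewrite zy f_y -zy.
rewrite /f /index (negPf zx) (negPf zy) asboolT //=.
by apply: (@xgetPex _ 0 [set c | e c c]); exists z.
Qed.

Let f_side z : same_side e x z -> ~ e z z -> same_side e x (f z).
Proof.
move=> xz zz; have [->|zx] := eqVneq z x; first by rewrite f_x; left.
have [zy|zy] := eqVneq z y; first by rewrite zy f_y -zy.
by rewrite /f /index (negPf zx) (negPf zy) asboolF // asboolT //; left.
Qed.

Let f_neighbour z : e x z -> ~ same_side e x z -> ~ e z z -> e x (f z).
Proof.
move=> xz sxz zz; have [zx|zx] := eqVneq z x; first by case: sxz; left.
have [zy|zy] := eqVneq z y; first by rewrite zy f_y -zy.
rewrite /f /index (negPf zx) (negPf zy) asboolF // asboolF // asboolT //=.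
exact: neighbourP xz.
Qed.

Let f_side' z : ~ same_side e x z -> ~ e x z -> same_side e y z -> ~ e z z ->
  f z = y.
Proof.
move=> sxz xz yz zz; have [zx|zx] := eqVneq z x; first by case: sxz; left.
have [zy|zy] := eqVneq z y; first by rewrite zy f_y.
by rewrite /f /index (negPf zx) (negPf zy) asboolF // asboolF // asboolF // asboolT.
Qed.

Let f_neighbour' z : ~ same_side e x z -> ~ e x z -> ~ same_side e y z ->
  e y z -> ~ e z z -> f z = neighbour y.
Proof.
move=> sxz xz syz yz zz; have [zx|zx] := eqVneq z x; first by case: sxz; left.
have [zy|zy] := eqVneq z y; first by case: syz; left.
rewrite /f /index (negPf zx) (negPf zy).
by rewrite asboolF // asboolF // asboolF // asboolF // asboolT.
Qed.

Let f_other z b : ~ same_side e x z -> ~ e x z -> ~ same_side e y z ->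
  ~ e y z -> ~ e z z -> e z b ->
  f z = if colour z then edge_pair.1 else edge_pair.2.
Proof.
move=> sxz xz syz yz zz zb.
have [zx|zx] := eqVneq z x; first by case: sxz; left.
have [zy|zy] := eqVneq z y; first by case: syz; left.
rewrite /f /index (negPf zx) (negPf zy).
rewrite asboolF // asboolF // asboolF // asboolF // asboolF // asboolT; last by exists b.
by case: colour.
Qed.

Let side_edge s a b : same_side e s a -> e a b -> e s b.
Proof. by move=> sa ab; apply: (same_side_edge eC eW sa (or_introl erefl) ab). Qed.

Let side_not_edge s a b :
  same_side e s a -> e a b -> ~ e a a -> ~ same_side e s b.
Proof.
move=> sa ab aa sb; apply: aa; have ss := same_side_edge eC eW sa sb ab.
have := loop_neighbour ss (side_edge sa ab).
by move/loop_neighbour; apply; apply: eC.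
Qed.

Let f_edge_side a b : e a b -> ~ e a a -> same_side e x a -> e (f a) (f b).
Proof.
move=> ab aa xa; have bb : ~ e b b.
  by move=> bb; apply: aa; exact: loop_neighbour bb (eC ab).
have xfb : e x (f b).
  by apply: f_neighbour => //; [exact: side_edge xa ab|exact: side_not_edge ab aa].
by case: (f_side xa aa) => [->//|[c xc fac]]; apply: eW fac (eC xc) xfb.
Qed.

Let f_edge_side' a b : e a b -> ~ e a a -> ~ same_side e x a -> ~ e x a ->
  same_side e y a -> e (f a) (f b).
Proof.
move=> ab aa sxa xa ya.
have bb : ~ e b b.
  by move=> bb; apply: aa; exact: loop_neighbour bb (eC ab).
have xb : ~ e x b.
  by move=> xb; apply: sxa; right; exists b.
have sxb : ~ same_side e x b by move/side_edge => /(_ _ (eC ab)).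
have yb := side_edge ya ab.
rewrite f_side' // f_neighbour' //; first exact: neighbourP yb.
exact: side_not_edge ab aa.
Qed.

Let f_edge a b : e a b -> e (f a) (f b).
Proof.
move=> ab; have ba := eC ab.
have [aa|aa] := pselect (e a a).
  by apply: e_clique; apply: f_loop => //; apply: loop_neighbour ab.
have bb : ~ e b b by move=> bb; apply: aa; exact: loop_neighbour bb ba.
have flip s : e s a -> same_side e s b by move=> sa; right; exists a.
have flip' s : e s b -> same_side e s a by move=> sb; right; exists b.
have [sxa|sxa] := pselect (same_side e x a); first exact: f_edge_side.
have [sxb|sxb] := pselect (same_side e x b); first by apply/eC/f_edge_side.
have xa : ~ e x a by move/flip.
have xb : ~ e x b by move/flip'.
have [sya|sya] := pselect (same_side e y a); first exact: f_edge_side'.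
have [syb|syb] := pselect (same_side e y b); first by apply/eC/f_edge_side'.
have ya : ~ e y a by move/flip.
have yb : ~ e y b by move/flip'.
rewrite (f_other (b := b)) // (f_other (b := a) (z := b)) // (colour_edge ab aa).
have pairP : e edge_pair.1 edge_pair.2.
  by apply: (@xgetPex _ (0, 0) [set c | e c.1 c.2]); exists (a, b).
by case: colour => //; apply: eC.
Qed.

(** Endomorphisms of the relation [e] fixing [x] and [y] can be chosen with at most
    seven values: one vertex for the loops, one for each side of the components of
    [x] and [y], and, as the colour is constant on sides, a single edge for
    all other bipartite components. The isolated vertices share the index
    7, which does not stand for a vertex. *)
Lemma walk_closed_retraction :
  exists rho r : nat -> nat,
  [/\ forall z, rho z < 8,
      rho x < 7 /\ r (rho x) = x,
      rho y < 7 /\ r (rho y) = y,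
      forall a b, e a b -> rho a < 7 /\ e (r (rho a)) (r (rho b)) &
      forall z, [\/ rho z = 7, exists b, e z b | r (rho z) = z]].
Proof.
exists index, vertex; split.
- by move=> z; rewrite /index; do !case: ifP.
- by split; [rewrite /index eqxx|exact: f_x].
- by split; [rewrite /index eqxx; case: ifP|exact: f_y].
- move=> a b ab; split; last exact: f_edge.
  rewrite /index (@asboolT (exists _, _)); last by exists b.
  by do !case: ifP.
- move=> z; have [zb|zb] := pselect (exists b, e z b); first by apply: Or32.
  have [zx|zx] := eqVneq z x; first by apply: Or33; rewrite zx; exact: f_x.
  have [zy|zy] := eqVneq z y; first by apply: Or33; rewrite zy; exact: f_y.
  have zz : ~ e z z by move=> zz; apply: zb; exists z.
  have sxz : ~ same_side e x z.
    by case=> [/eqP|[b _ zb']]; [rewrite (negPf zx)|apply: zb; exists b].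
  have syz : ~ same_side e y z.
    by case=> [/eqP|[b _ zb']]; [rewrite (negPf zy)|apply: zb; exists b].
  have xz : ~ e x z by move=> xz; apply: zb; exists x; apply: eC.
  have yz : ~ e y z by move=> yz; apply: zb; exists y; apply: eC.
  by apply: Or31; rewrite /index (negPf zx) (negPf zy) !asboolF.
Qed.

End Retraction.

(** Monomials of degree at least three are preserved because, by [loop_cube], the image
    of a variable whose cube is below [t] is again such a variable. The index 7 is
    given the value [t]. *)
Lemma eight_variables (S : algebra) (v : nat -> S) (t : S) (x y : nat) :
  calK S ->
  exists (rho : nat -> nat) (u : nat -> S),
  [/\ forall z, rho z < 8, u (rho x) = v x, u (rho y) = v y &
      forall w, w != [::] -> meval v w <<= t -> meval (u \o rho) w <<= t].
Proof.
move=> /calKP[SA SK]; have HS := A_ai SA.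
pose e a b := edge t (v a) (v b).
have eC a b : e a b -> e b a by exact: (edgeC SA).
have eW a b c d : e a b -> e b c -> e c d -> e a d by exact: SK.
have e_clique a b : e a a -> e b b -> e a b by exact: (A_clique SA).
have [rho [r [rho8 [x7 rx] [y7 ry] r_edge r_iso]]] :=
  walk_closed_retraction eC eW e_clique x y.
pose u k := if k < 7 then v (r k) else t.
have u_edge a b : e a b -> u (rho a) = v (r (rho a)).
  by rewrite /u => /r_edge[-> _].
exists rho, u; split=> //; rewrite /u ?x7 ?y7 ?rx ?ry //.
rewrite -/u => w; case: w => // a [|b [|c w]] _ wt.
- rewrite /meval /= -/(u _) /u; case: ltnP => // [a7|_]; last exact: lexx.
  case: (r_iso a) => [a7'|[b ab]|->//]; first by rewrite a7' in a7.
  have [_ /(edge_le SA)//] := r_edge _ _ ab.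
- have ab : e a b by [].
  rewrite /meval /= (u_edge _ _ ab) (u_edge _ _ (eC _ _ ab)).
  by have [] := r_edge _ _ ab.
move/(meval_le_cubes SA SK): wt => wt; apply/(meval_le_cubes SA SK) => // z zw.
have z3 := wt isT z zw; have zz : e z z by exact: (cube_square SA).
rewrite /= (u_edge _ _ zz); apply: (loop_cube SA SK) z3.
by have [] := r_edge _ _ zz.
Qed.

(** ** Local finiteness of K *)

Definition subsequences (T : eqType) (s : seq T) : seq (seq T) :=
  map (fun b : (size s).-tuple bool => mask b s) (enum {: (size s).-tuple bool}).

Lemma filter_subsequences (T : eqType) (P : pred T) s : seq.filter P s \in subsequences s.
Proof.
apply/mapP; exists (map_tuple P (in_tuple s)); first exact: mem_enum.
by rewrite filter_mask.
Qed.

(** Representatives of the monomials of degree at least three up to [K_equivalent];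
    tripling keeps the degree large when there are one or two variables only. *)
Definition triples (s : seq nat) : seq nat := flatten [seq nseq 3 x | x <- s].

Definition small_monomials n : seq (seq nat) :=
  [seq [:: x] | x <- iota 0 n] ++
  [seq [:: x; y] | x <- iota 0 n, y <- iota 0 n] ++
  [seq triples s | s <- subsequences (iota 0 n)].

Definition small_terms n : seq term :=
  [seq sum_term ws | ws <- subsequences (small_monomials n)].

Definition K_equivalent (w w' : seq nat) : Prop :=
  forall (S : algebra) (v : nat -> S) t, calK S ->
    meval v w <<= t <-> meval v w' <<= t.

Lemma mem_triples x s : (x \in triples s) = (x \in s).
Proof.
apply/flatten_mapP/idP => [[y ys]|xs]; first by rewrite mem_nseq => /eqP->.
by exists x; rewrite // mem_nseq eqxx.
Qed.

Lemma size_triples s : size (triples s) = 3 * size s.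
Proof. by elim: s => //= x s; rewrite /triples /= => ->; lia. Qed.

Lemma small_monomialP n w : w != [::] -> {in w, forall x, x < n} ->
  exists w', [/\ w' \in small_monomials n, w' != [::] & K_equivalent w w'].
Proof.
case: w => // x [|y [|z w]] _ wn.
- exists [:: x]; split=> //; rewrite /small_monomials mem_cat; apply/orP; left.
  by apply/map_f; rewrite mem_iota /= wn ?inE.
- exists [:: x; y]; split=> //; rewrite /small_monomials !mem_cat.
  apply/orP; right; apply/orP; left; apply/allpairsP; exists (x, y).
  by rewrite /= !mem_iota /= !wn ?inE ?eqxx ?orbT.
set u := [:: x, y, z & w] in wn *.
pose s := seq.filter (fun a => a \in u) (iota 0 n).
have su a : (a \in triples s) = (a \in u).
  rewrite mem_triples mem_filter mem_iota /=.
  by case: (boolP (a \in u)) => //= /wn.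
have t3 : 2 < size (triples s).
  have : x \in triples s by rewrite su inE eqxx.
  rewrite mem_triples size_triples; case: s {su} => // a s' _.
  by rewrite mulnS.
exists (triples s); split.
- rewrite /small_monomials !mem_cat; apply/orP; right; apply/orP; right.
  exact/map_f/filter_subsequences.
- by case: (triples s) t3.
- move=> S v t /calKP[SA SK]; rewrite !(meval_le_cubes SA SK) //.
  by split=> h a; [rewrite su|rewrite -su]; apply: h.
Qed.

Lemma small_termP n p : {in variables p, forall x, x < n} ->
  exists2 q, q \in small_terms n & forall S, calK S -> satisfies S (p, q).
Proof.
move=> pn.
pose Q w' := `[< w' != [::] /\
  exists2 w, w \in monomials p & K_equivalent w w' >].
pose ws := seq.filter Q (small_monomials n).
have reduce w : w \in monomials p -> exists2 w', w' \in ws & K_equivalent w w'.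
  move=> wp; have [|w' [w'n w'0 ww']] := @small_monomialP n w (monomials_neq0 wp).
    by move=> x xw; apply: pn; apply: monomials_variables xw.
  by exists w' => //; rewrite mem_filter w'n andbT; apply/asboolP; split; last exists w.
have ws0 : ws != [::].
  by have [w /reduce[w' + _]] := monomials_nonempty p; case: (ws).
have ws1 : {in ws, forall w, w != [::]}.
  by move=> w; rewrite mem_filter => /andP[/asboolP[]].
exists (sum_term ws); first exact/map_f/filter_subsequences.
move=> S KS v /=; have HS := A_ai (proj1 ((calKP S).1 KS)).
apply: (le_eq HS) => t; rewrite (le_monomials HS) (le_sum_term HS) //.
split=> h w.
  by rewrite mem_filter => /andP[/asboolP[_ [w' /h w't /(_ S v t KS)[+ _]]] _]; apply.
by move=> /reduce[w' /h w't /(_ S v t KS)[_]]; apply.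
Qed.

Definition small_identities : seq identity :=
  [seq (p, q) | p <- small_terms 8, q <- small_terms 8].

Fixpoint rename (f : nat -> nat) (p : term) : term :=
  match p with
  | Var n => Var (f n)
  | TAdd p q => TAdd (rename f p) (rename f q)
  | TMul p q => TMul (rename f p) (rename f q)
  end.

Lemma eval_rename (S : algebra) (v : nat -> S) f p :
  eval v (rename f p) = eval (v \o f) p.
Proof. by elim: p => //= p -> q ->. Qed.

Lemma variables_rename f p : variables (rename f p) = map f (variables p).
Proof. by elim: p => //= p -> q ->; rewrite map_cat. Qed.

(** ** Subvarieties of K are determined by small identities *)

Section SmallIdentities.
Variable W : set algebra.
Hypotheses (WV : is_variety W) (WK : W `<=` calK).

Definition K_basis : seq identity :=
  K_identities ++ seq.filter (fun e => `[< identities_of W e >]) small_identities.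

Section Model.
Variables (S : algebra) (SW : models [set` K_basis] S).

Let KS : calK S.
Proof.
rewrite -models_K_identities => e /= eK; apply: SW.
by rewrite /= mem_cat eK.
Qed.

Let SA : A_laws S := proj1 ((calKP S).1 KS).
Let SK : walk_closed S := proj2 ((calKP S).1 KS).
Let HS := A_ai SA.

Let small_sound p q :
  {in variables p, forall x, x < 8} -> {in variables q, forall x, x < 8} ->
  identities_of W (p, q) -> satisfies S (p, q).
Proof.
move=> /small_termP[p' p's pp'] /small_termP[q' q's qq'] Wpq v.
rewrite /= (pp' S KS v) (qq' S KS v) /=.
have : satisfies S (p', q').
  apply: SW; rewrite /= mem_cat; apply/orP; right; rewrite mem_filter.
  apply/andP; split; last by apply/allpairsP; exists (p', q').
  apply/asboolP => T WT u /=; have KT := WK WT.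
  by rewrite -(pp' T KT u) -(qq' T KT u); apply: Wpq.
exact.
Qed.

(** Whether [w <= p] holds in [S] at [v] is decided after a substitution of eight
    variables that depends on [v]. *)
Let short_monomial p w x y : w != [::] -> {subset w <= [:: x; y]} ->
  (forall (T : algebra) (u : nat -> T), W T -> meval u w <<= eval u p) ->
  forall v : nat -> S, meval v w <<= eval v p.
Proof.
move=> w0 wxy Wwp v.
have [rho [u [rho8 ux uy u_le]]] := eight_variables v (eval v p) x y KS.
have -> : meval v w = meval (u \o rho) w.
  by apply: meval_ext => // z /wxy; rewrite !inE => /orP[] /eqP->.
have small q : {in variables (rename rho q), forall z, z < 8}.
  by move=> z; rewrite variables_rename => /mapP[z' _ ->].
have : satisfies S (rename rho (TAdd (monomial_term w) p), rename rho p).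
  by apply: small_sound => // T WT u'; rewrite !eval_rename; apply: Wwp.
move/(_ u); rewrite !eval_rename => le_wp; apply: (le_trans HS le_wp).
apply/(le_monomials HS) => w' w'p; apply: u_le; first exact: monomials_neq0 w'p.
by move/(le_monomials HS): (lexx HS (eval v p)); apply.
Qed.

Let monomial_sound p q (v : nat -> S) w :
  identities_of W (p, q) -> w \in monomials q -> meval v w <<= eval v p.
Proof.
move=> Wpq wq; have w0 := monomials_neq0 wq.
have Wwp (T : algebra) (u : nat -> T) : W T -> meval u w <<= eval u p.
  move=> WT; have HT := A_ai (proj1 ((calKP T).1 (WK WT))).
  exact: (monomial_identity HT (Wpq T WT) wq u).
case: w w0 wq Wwp => // x [|y [|z w]] _ wq Wwp.
- by apply: (@short_monomial p [:: x] x x) => // a; rewrite !inE => ->.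
- exact: (@short_monomial p [:: x; y] x y).
apply/(meval_le_cubes SA SK) => // a aw.
suff : meval v [:: a; a; a] <<= eval v p.
  by rewrite /cube_le -(ai_mulA HS).
apply: (@short_monomial p _ a a) => // [b|T u WT].
  by rewrite !inE => /orP[->|].
have /calKP[TA TK] := WK WT.
have /(@meval_le_cubes _ TA TK _ [:: x, y, z & w] _ isT)/(_ a aw) := Wwp T u WT.
by rewrite /cube_le -(ai_mulA (A_ai TA)).
Qed.

Lemma K_basis_complete : W S.
Proof.
apply: birkhoff => // -[p q] Wpq; apply: (le_of_identities HS) => v w.
  exact: monomial_sound.
by apply: monomial_sound => T WT u; rewrite (Wpq T WT u).
Qed.

End Model.

Lemma models_K_basis : models [set` K_basis] = W.
Proof.
apply/seteqP; split=> S; first exact: K_basis_complete.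
move=> WS e /=; rewrite mem_cat => /orP[eK|].
  by have := WK WS; rewrite -models_K_identities; apply.
by rewrite mem_filter => /andP[/asboolP We _]; apply: We.
Qed.

End SmallIdentities.

Lemma subvariety_K_finitely_based W : subvariety W calK -> finitely_based W.
Proof.
case=> WV WK; exists [set` K_basis W]; split; first exact: finite_seq.
by rewrite models_K_basis.
Qed.

Lemma finite_subvarieties_K : finite_set [set W | subvariety W calK].
Proof.
apply: (@sub_finite_set _ _ [set models [set` K_identities ++ s] |
                             s in [set` subsequences small_identities]]).
  move=> W [WV WK]; rewrite -(models_K_basis WV WK) /=.
  exists (seq.filter (fun e => `[< identities_of W e >]) small_identities) => //.
  exact: filter_subsequences.
exact/finite_image/finite_seq.
Qed.

(** * The bipartite theory *)

(** [c] properly colours the monomials of [p], seen as the edges of a graph on the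
    variables, linear monomials being isolated vertices. *)
Definition coloured_monomial (c : nat -> bool) (w : seq nat) : bool :=
  match w with [:: _] => true | [:: x; y] => c x != c y | _ => false end.

Definition colouring (c : nat -> bool) (p : term) : bool :=
  all (coloured_monomial c) (monomials p).

Definition below (p : term) (w : seq nat) : bool :=
  match w with
  | [:: x] => x \in variables p
  | [:: x; y] => ([:: x; y] \in monomials p) || ([:: y; x] \in monomials p)
  | _ => false
  end.

Definition bipartite_le (q p : term) : Prop :=
  forall c, colouring c p -> {in monomials q, forall w, below p w}.

(** Up to the laws of commutative ai-semirings and [x <= x y], the only terms that get
    identified are those whose graphs are not bipartite. *)
Definition bipartite_theory : set identity :=
  [set e | bipartite_le e.2 e.1 /\ bipartite_le e.1 e.2].

Section Refutation.
Variables (S : algebra) (SA : A_laws S).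
Let HS := A_ai SA.

Lemma le_coloured (v : nat -> S) t c p : colouring c p ->
  {in variables p, forall x, v x <<= t} ->
  (forall x y, c x -> ~~ c y -> below p [:: x; y] -> v x ** v y <<= t) ->
  eval v p <<= t.
Proof.
move=> /allP pc p1 p2; apply/(le_monomials HS) => w wp; have := pc w wp.
have wv := monomials_variables wp.
case: w wp wv => // x [|y [|//]] wp wv /= xy; first by apply: p1; apply: wv; rewrite inE.
rewrite /meval /=; case cx: (c x) xy; case cy: (c y) => // _.
  by apply: p2; rewrite ?cx ?cy //= wp.
by rewrite (ai_mulC HS); apply: p2; rewrite ?cx ?cy //= wp orbT.
Qed.

Lemma meval_pair (v : nat -> S) x y z w (t := meval v [:: x, y, z & w]) :
  [/\ v x ** v y <<= t, v x ** v z <<= t & v y ** v z <<= t].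
Proof.
have xyz : v x ** v y ** v z <<= t.
  rewrite {}/t -(ai_mulA HS); case: w => [|a w]; first exact: lexx.
  rewrite !(@meval_cons _ _ _ (_ :: _)) // (ai_mulA HS (v y)).
  by rewrite (ai_mulA HS _ (_ ** _)); apply: (A_mul SA).
split; apply: (le_trans HS _ xyz).
- exact: (A_mul SA).
- by rewrite (mulAC HS); apply: (A_mul SA).
- by rewrite -(ai_mulA HS) (ai_mulC HS (v x)); apply: (A_mul SA).
Qed.

Variables b0 b1 : S.
Hypothesis b01 : ~ b0 ** b0 <<= b0 ** b1.

Let two (c : nat -> bool) (x : nat) : S := if c x then b0 else b1.

Let two_le c p : colouring c p -> eval (two c) p <<= b0 ** b1.
Proof.
have b0t : b0 <<= b0 ** b1 by apply: (A_mul SA).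
have b1t : b1 <<= b0 ** b1 by rewrite (ai_mulC HS); apply: (A_mul SA).
move=> pc; apply: (le_coloured pc) => [x _|x y cx cy _].
  by rewrite /two; case: ifP.
by rewrite /two cx (negPf cy); apply: (lexx HS).
Qed.

Let colouring_flip c p : colouring c p -> colouring (fun x => ~~ c x) p.
Proof.
move=> /allP pc; apply/allP => w /pc; case: w => // x [|y []] //=.
by case: (c x); case: (c y).
Qed.

(** Two occurrences of variables of the same colour multiply to [b0 ** b0]. *)
Let same_colour c p x y w : colouring c p -> c x = c y ->
  (forall v : nat -> S, v x ** v y <<= meval v w) ->
  exists v : nat -> S, ~ meval v w <<= eval v p.
Proof.
move=> pc cxy xyw.
have [c' pc' [c'x c'y]] : exists2 c', colouring c' p & c' x /\ c' y.
  case cx: (c x); first by exists c; rewrite // -cxy cx.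
  by exists (fun x => ~~ c x); [exact: colouring_flip|rewrite -cxy cx].
exists (two c') => wp; apply: b01.
apply: (le_trans HS _ (le_trans HS wp (two_le pc'))).
by have := xyw (two c'); rewrite /two c'x c'y.
Qed.

(** A variable that does not occur in [p] is free to take the value [b0 ** b0]. *)
Let missing c p x w : colouring c p -> x \notin variables p ->
  (forall v : nat -> S, v x <<= meval v w) ->
  exists v : nat -> S, ~ meval v w <<= eval v p.
Proof.
move=> pc xp xw; pose v z := if z == x then b0 ** b0 else two c z.
exists v => wp; apply: b01; apply: (le_trans HS (b := eval v p)).
  by apply: (le_trans HS _ wp); have := xw v; rewrite /v eqxx.
rewrite (_ : eval v p = eval (two c) p); first exact: two_le.
by apply: eval_ext => z zp; rewrite /v; case: eqP => // zx; rewrite -zx zp in xp.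
Qed.

Variables (t a1 a2 a3 a4 : S).
Hypotheses (a12 : edge t a1 a2) (a23 : edge t a2 a3) (a34 : edge t a3 a4).
Hypothesis a14 : ~ edge t a1 a4.

(** Non-adjacent variables of different colours go to the ends of the path
    [a1 a2 a3 a4], and all other variables to its middle. *)
Let across c p x y : colouring c p -> c x -> ~~ c y -> ~~ below p [:: x; y] ->
  exists v : nat -> S, ~ meval v [:: x; y] <<= eval v p.
Proof.
move=> pc cx cy xyp.
pose v z := if c z then if z == x then a1 else a3
            else if z == y then a4 else a2.
exists v => xy; apply: a14; rewrite /edge.
apply: (le_trans HS (b := eval v p)).
  by move: xy; rewrite /meval /= /v cx eqxx (negPf cy) eqxx.
apply: (le_coloured pc) => [z _|z z' cz cz' zz'].
  rewrite /v; do !case: ifP => _.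
  - exact: (edge_le SA a12).
  - exact: (edge_le SA a34).
  - exact: (edge_le SA (edgeC SA a34)).
  - exact: (edge_le SA a23).
rewrite /v cz (negPf cz'); case: eqP => zx; case: eqP => z'y //.
- by move: xyp; rewrite -zx -z'y zz'.
- exact: (edgeC SA a23).
Qed.

Lemma refutation p q w : w \in monomials q -> ~~ below p w ->
  (exists c, colouring c p) -> exists v : nat -> S, ~ meval v w <<= eval v p.
Proof.
move=> wq pw [c pc]; have w0 := monomials_neq0 wq.
case: w w0 wq pw => // x [|y [|z w]] _ _ pw.
- by apply: (missing pc pw) => v; apply: (lexx HS).
- have [xp|xp] := boolP (x \in variables p); last first.
    by apply: (missing pc xp) => v; apply: (A_mul SA).
  have [yp|yp] := boolP (y \in variables p); last first.
    by apply: (missing pc yp) => v; rewrite /meval /= (ai_mulC HS); apply: (A_mul SA).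
  have [cxy|cxy] := eqVneq (c x) (c y).
    by apply: (same_colour pc cxy) => v; apply: (lexx HS).
  case cx: (c x) cxy; case cy: (c y) => // _.
    by apply: (across pc); rewrite ?cx ?cy.
  have [||| v vyx] := @across c p y x pc; rewrite ?cx ?cy //=; first by rewrite orbC.
  by exists v; move: vyx; rewrite /meval /= (ai_mulC HS).
- have [cxy|cxy] := eqVneq (c x) (c y).
    by apply: (same_colour pc cxy) => v; have [] := meval_pair v x y z w.
  have [cxz|cxz] := eqVneq (c x) (c z).
    by apply: (same_colour pc cxz) => v; have [] := meval_pair v x y z w.
  have cyz : c y = c z by case: (c x) (c y) (c z) cxy cxz => [] [] [].
  by apply: (same_colour pc cyz) => v; have [] := meval_pair v x y z w.
Qed.

End Refutation.

(** The walk [a1 a2 a3 a4] witnesses that [S] is not in K. Elements [b0], [b1] as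
    required by [refutation] then exist, as otherwise [a1 ** a1] and [a4 ** a4] would be
    below [t], and the clique law would close the walk. *)
Lemma bipartite_of_identity (S : algebra) p q : A_laws S -> ~ walk_closed S ->
  satisfies S (p, q) -> bipartite_le q p.
Proof.
move=> SA nSK pq c pc w wq; have HS := A_ai SA.
have [t [a1 [a2 [a3 [a4 [a12 a23 a34 a14]]]]]] :
    exists t a1 a2 a3 a4 : S,
      [/\ edge t a1 a2, edge t a2 a3, edge t a3 a4 & ~ edge t a1 a4].
  apply: contrapT => nex; apply: nSK => t a1 a2 a3 a4 h12 h23 h34.
  by apply: contrapT => h14; apply: nex; exists t, a1, a2, a3, a4.
have [b0 [b1 b01]] : exists b0 b1 : S, ~ b0 ** b0 <<= b0 ** b1.
  apply: contrapT => nex; apply: a14.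
  have sq (a b : S) : a ** a <<= a ** b.
    by apply: contrapT => ab; apply: nex; exists a, b.
  apply: (A_clique SA); first exact: (le_trans HS (sq a1 a2)).
  exact: (le_trans HS (sq a4 a3) (edgeC SA a34)).
apply: contraT => pw.
have [//|v vwp] := refutation SA b01 a12 a23 a34 a14 wq pw; first by exists c.
case: vwp; have /= -> := pq v.
by move/(le_monomials HS): (lexx HS (eval v q)); apply.
Qed.

(** * Graph algebras *)

Section GraphAlgebra.
Variable G : rel nat.
Hypotheses (GC : symmetric G) (Girr : irreflexive G).

Definition vertices : Set := {A : nat -> bool | exists x, A x}.

(** [Some (Some A)] is a nonempty set of vertices; two such sets multiply to
    [Some None] when all pairs are adjacent; all other products are [None]. The order
    is inclusion of vertex sets, followed by [Some None] and [None]. *)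
Definition gcarrier : Set := option (option vertices).

Definition union_set (A B : nat -> bool) (x : nat) : bool := A x || B x.

Lemma union_nonempty (A B : vertices) :
  exists x, union_set (projT1 A) (projT1 B) x.
Proof. by case: A => A [x Ax]; exists x; rewrite /union_set /= Ax. Qed.

Definition union (A B : vertices) : vertices :=
  exist (fun A : nat -> bool => exists x, A x) _ (union_nonempty A B).

Definition gadd (a b : gcarrier) : gcarrier :=
  match a, b with
  | Some (Some A), Some (Some B) => Some (Some (union A B))
  | None, _ | _, None => None
  | _, _ => Some None
  end.

Definition complete (A B : nat -> bool) : bool :=
  `[< forall x y, A x -> B y -> G x y >].

Definition gmul (a b : gcarrier) : gcarrier :=
  match a, b with
  | Some (Some A), Some (Some B) =>
      if complete (projT1 A) (projT1 B) then Some None else None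
  | _, _ => None
  end.

Definition graph_algebra : algebra := @Algebra gcarrier gadd gmul (inhabits None).

Lemma completeC A B : complete A B = complete B A.
Proof. by apply/asboolP/asboolP => h x y xA yB; rewrite GC h. Qed.

Lemma completeU A B C :
  complete (union_set A B) C = complete A C && complete B C.
Proof.
apply/asboolP/andP => [h|[/asboolP hA /asboolP hB] x y].
  by split; apply/asboolP => x y xA; apply: h; rewrite /union_set xA ?orbT.
by case/orP=> [/hA|/hB]; apply.
Qed.

Lemma graph_algebra_ai : comm_ai_semiring graph_algebra.
Proof.
have aC : commutative gadd.
  move=> [[A|]|] [[B|]|] //=; congr (Some (Some _)).
  by apply/eq_exist/funext => x; rewrite /union_set orbC.
have mC : commutative gmul by move=> [[A|]|] [[B|]|] //=; rewrite completeC.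
have mD : left_distributive gmul gadd.
  by move=> [[A|]|] [[B|]|] [[C|]|] //=; rewrite ?completeU /=; do 2?[case: complete => //=].
split=> //=.
- move=> [[A|]|] [[B|]|] [[C|]|] //=; congr (Some (Some _)).
  by apply/eq_exist/funext => x; rewrite /union_set /= orbA.
- move=> [[[A A0]|]|] //=; congr (Some (Some _)).
  by apply/eq_exist/funext => x; rewrite /union_set /= orbb.
- by move=> [[A|]|] [[B|]|] [[C|]|] //=; do 2?[case: complete => //=].
- by move=> a b c; rewrite ![_ a _]mC mD.
Qed.

Lemma complete_loop (A : vertices) : complete (projT1 A) (projT1 A) = false.
Proof.
by case: A => A [x xA]; apply/negP => /asboolP/(_ x x xA xA); rewrite Girr.
Qed.

Lemma graph_algebra_A : A_laws graph_algebra.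
Proof.
split; first exact: graph_algebra_ai.
- by move=> [[A|]|] [[B|]|] //=; rewrite /le /=; case: complete.
- move=> a b t aa _; suff -> : t = None by rewrite /le /=; case: gmul => [[]|].
  have a2 : amul a a = None by case: a {aa} => [[A|]|] //=; rewrite complete_loop.
  by move: aa; rewrite a2; case: t => [[C|]|].
Qed.

Let HG := graph_algebra_ai.
Let GA := graph_algebra_A.

(** If few vertices always induce a bipartite graph, then an identity of the
    bipartite theory with few variables cannot see that the graph is not bipartite:
    where [p] has a value other than [None], picking one vertex from the value of each
    variable turns a colouring of vertices into a colouring of [p]. *)
Lemma graph_algebra_bipartite_le (v : nat -> graph_algebra) p q :
  (forall phi : nat -> nat, exists c : nat -> bool,
     {in variables p &, forall x y, G (phi x) (phi y) -> c x != c y}) ->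
  bipartite_le q p -> eval v q <<= eval v p.
Proof.
move=> small qp; have pE w : w \in monomials p -> meval v w <<= eval v p.
  by move/(le_monomials HG): (lexx HG (eval v p)); apply.
have [E|E] := pselect (eval v p = None).
  by rewrite E /le /=; case: (eval v q) => [[]|].
have notNone (a : graph_algebra) : a <<= eval v p -> a <> None.
  by move=> + a0; rewrite a0 /le /= => /esym.
have phiP x : exists r, forall A, v x = Some (Some A) -> projT1 A r.
  case: (v x) => [[A|]|]; try by exists 0.
  by case: A => A [r rA]; exists r => B [<-].
have [phi phiE] := choice phiP; have [c cP] := small phi.
have pc : colouring c p.
  apply/allP => w wp; have wN := notNone _ (pE w wp).
  have wv := monomials_variables wp; have := monomials_neq0 wp.
  case: w wp wN wv => // x [|y [|z w]] // wp wN wv _ /=; last first.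
    case: wN; rewrite !(@meval_cons _ _ _ (_ :: _)) //=.
    by case: (v x) (v y) (meval v (z :: w)) => [[A|]|] [[B|]|] [[C|]|] //=;
      case: complete.
  apply: cP; [by apply: wv; rewrite inE eqxx|by apply: wv; rewrite !inE eqxx orbT|].
  move: wN (phiE x) (phiE y); rewrite /meval /=.
  case: (v x) (v y) => [[A|]|] [[B|]|] //=; rewrite /complete; case: asboolP => // AB _ hx hy.
  by apply: AB; [apply: hx|apply: hy].
apply/(le_monomials HG) => w wq; have w0 := monomials_neq0 wq.
move: (qp c pc w wq) w0; case: w {wq} => // x [|y [|//]] /=.
  move=> /variables_monomials[w wp xw] _; exact: (meval_var_le GA xw (pE w wp)).
case/orP=> [/pE //|/pE yx _].
by rewrite [meval v _](ai_mulC HG (v x) (v y)).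
Qed.

Lemma graph_algebra_bipartite_theory e :
  (forall phi : nat -> nat, exists c : nat -> bool,
     {in variables e.1 ++ variables e.2 &, forall x y,
        G (phi x) (phi y) -> c x != c y}) ->
  bipartite_theory e -> satisfies graph_algebra e.
Proof.
move=> small [le21 le12] v; apply: (le_anti HG); apply: graph_algebra_bipartite_le => //
  phi; have [c cP] := small phi; exists c => x y xp yp; apply: cP;
  by rewrite mem_cat ?xp ?yp ?orbT.
Qed.

Definition singleton (x y : nat) : bool := y == x.

Lemma singleton_nonempty x : exists y, singleton x y.
Proof. by exists x; apply: eqxx. Qed.

Definition vertex (x : nat) : graph_algebra :=
  Some (Some (exist (fun A : nat -> bool => exists x, A x) _ (singleton_nonempty x))).

Lemma vertex_mul x y :
  amul (vertex x) (vertex y) = (if G x y then Some None else None) :> gcarrier.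
Proof.
rewrite /= (_ : complete _ _ = G x y) //; apply/asboolP/idP => [|xy a b /eqP-> /eqP-> //].
by apply; apply: eqxx.
Qed.

End GraphAlgebra.

(** ** Paths and odd cycles *)

Definition path_rel : rel nat := fun i j => (i.+1 == j) || (j.+1 == i).

Definition path_algebra : algebra := graph_algebra path_rel.

Lemma path_rel_sym : symmetric path_rel.
Proof. by move=> i j; rewrite /path_rel orbC. Qed.

Lemma path_rel_irr : irreflexive path_rel.
Proof. by move=> i; rewrite /path_rel; lia. Qed.

Lemma path_algebra_bipartite : models bipartite_theory path_algebra.
Proof.
move=> e; apply: (graph_algebra_bipartite_theory path_rel_sym path_rel_irr).
move=> phi; exists (fun x => odd (phi x)) => x y _ _; rewrite /path_rel; lia.
Qed.

Lemma path_algebra_not_walk_closed : ~ walk_closed path_algebra.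
Proof.
pose t : path_algebra := Some None.
have aE i j : edge t (vertex path_rel i) (vertex path_rel j) <-> path_rel i j.
  by rewrite /edge vertex_mul /le /t; case: path_rel.
move/(_ t (vertex _ 0) (vertex _ 1) (vertex _ 2) (vertex _ 3)).
by rewrite !aE => /(_ isT isT isT).
Qed.

Section OddCycle.
Variable N : nat.
Let n := N.*2.+3.

Let next (i : nat) : nat := i.+1 %% n.

Let nextE i : i < n -> next i = if i.+1 == n then 0 else i.+1.
Proof.
move=> i_n; rewrite /next; case: eqP => [->|ni]; first by rewrite modnn.
by rewrite modn_small //; lia.
Qed.

Definition cycle_rel : rel nat := fun i j =>
  [&& i < N.*2.+3, j < N.*2.+3 &
      (i.+1 %% N.*2.+3 == j) || (j.+1 %% N.*2.+3 == i)].

Definition cycle_algebra : algebra := graph_algebra cycle_rel.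

Lemma cycle_rel_sym : symmetric cycle_rel.
Proof. by move=> i j; rewrite /cycle_rel orbC andbCA. Qed.

Lemma cycle_rel_irr : irreflexive cycle_rel.
Proof.
move=> i; rewrite /cycle_rel orbb -/n -/(next i); case: ltnP => //= i_n.
by rewrite nextE //; case: ifP => //; rewrite /n; lia.
Qed.

(** Without the vertex [r] the cycle is a path; along it parity is a colouring,
    switched at [r] because the cycle is odd. *)
Lemma cycle_colouring r i j : r < n -> i != r -> j != r -> cycle_rel i j ->
  (odd i (+) (i < r)) != (odd j (+) (j < r)).
Proof.
move=> rn; have half a b : a < n -> b < n -> a != r -> b != r -> next a = b ->
    (odd a (+) (a < r)) != (odd b (+) (b < r)).
  move=> an bn ar br; rewrite nextE //; case: eqP => aE bE;
    by rewrite -bE in br *; rewrite /n in an bn rn aE; lia.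
move=> ir jr /and3P[i_n jn /orP[/eqP ij|/eqP ji]]; first exact: half.
by rewrite eq_sym; apply: half.
Qed.

Lemma cycle_algebra_bipartite e : bipartite_theory e ->
  size (variables e.1 ++ variables e.2) <= N -> satisfies cycle_algebra e.
Proof.
move=> eB eN; apply: (graph_algebra_bipartite_theory cycle_rel_sym cycle_rel_irr) => //.
move=> phi; set s := _ ++ _ in eN *.
have [r r_n rs] : exists2 r, r < n & r \notin map phi s.
  apply: contrapT => nr; have : size (iota 0 n) <= size (map phi s).
    apply: uniq_leq_size (iota_uniq _ _) _ => r; rewrite mem_iota /= => r_n.
    by apply: contraT => rs; case: nr; exists r.
  by rewrite size_iota size_map /n; lia.
exists (fun x => odd (phi x) (+) (phi x < r)) => x y xs ys; apply: (cycle_colouring r_n).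
  by apply: contraNneq rs => <-; apply: map_f.
by apply: contraNneq rs => <-; apply: map_f.
Qed.

Let cycle_term : term := sum_term [seq [:: i; next i] | i <- iota 0 n].

Let monomials_cycle_term : monomials cycle_term = [seq [:: i; next i] | i <- iota 0 n].
Proof. by apply: monomials_sum_term => // w /mapP[i _ ->]. Qed.

Let cycle_identity : identity := (cycle_term, TMul (Var 0) (Var 0)).

Lemma cycle_identity_bipartite : bipartite_theory cycle_identity.
Proof.
split=> c; last by rewrite /colouring /= eqxx.
rewrite /colouring monomials_cycle_term => /allP cP.
have step i : i < n -> c (next i) = ~~ c i.
  move=> i_n; have /cP /= : [:: i; next i] \in [seq [:: i; next i] | i <- iota 0 n].
    by apply/mapP; exists i; rewrite ?mem_iota.
  by case: (c i); case: (c _).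
have parity i : i < n -> c i = c 0 (+) odd i.
  elim: i => [|i IH] i_n; first by rewrite addbF.
  have := step i (ltnW i_n); rewrite nextE ?(ltnW i_n) //.
  case: eqP => [ni|_]; first by rewrite ni ltnn in i_n.
  by move=> ->; rewrite IH ?(ltnW i_n) //= addbN.
have := step N.*2.+2 (ltnSn _); rewrite nextE // eqxx (parity N.*2.+2) //= odd_double.
by case: (c 0).
Qed.

Lemma cycle_algebra_not_bipartite : ~ models bipartite_theory cycle_algebra.
Proof.
move=> /(_ _ cycle_identity_bipartite).
move/(_ (vertex cycle_rel)); rewrite [RHS]vertex_mul cycle_rel_irr.
have HC := graph_algebra_ai cycle_rel_sym.
have : eval (vertex cycle_rel) cycle_term <<= (Some None : cycle_algebra).
  apply/(le_monomials HC) => w; rewrite monomials_cycle_term => /mapP[i + ->].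
  rewrite mem_iota /= => i_n; rewrite /meval [eval _ _]vertex_mul.
  rewrite /cycle_rel -/n i_n ltn_mod /= eqxx; exact: (lexx HC).
by move=> + E; rewrite E.
Qed.

End OddCycle.

(** As [path_algebra] is an algebra of A outside K, the identities true in it belong to
    the bipartite theory; finitely many of them also hold for a long odd cycle. *)
Lemma bipartite_not_finitely_based : ~ finitely_based (models bipartite_theory).
Proof.
case=> E [/finite_seqP[s ->] BE].
pose N := \max_(e <- s) size (variables e.1 ++ variables e.2).
apply: (@cycle_algebra_not_bipartite N); rewrite BE => e /= es.
apply: cycle_algebra_bipartite; last by rewrite /N (big_rem e) //= leq_maxl.
have PA := graph_algebra_A path_rel_sym path_rel_irr.
have : models [set` s] path_algebra by rewrite -BE; apply: path_algebra_bipartite.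
case: e es => p q es /(_ _ es) pq.
split; apply: (bipartite_of_identity PA path_algebra_not_walk_closed) => //.
Qed.

(** A subvariety of A outside K contains all models of the bipartite theory, and these
    do not form a finitely based variety. *)
Lemma hereditarily_finitely_based_sub_calK W :
  W `<=` calA -> is_variety W -> hereditarily_finitely_based W -> W `<=` calK.
Proof.
move=> WA WV WH S WS; apply: contrapT => nKS.
have /calAP SA := WA S WS.
have nSK : ~ walk_closed S by move=> SK; apply/nKS/calKP.
apply: bipartite_not_finitely_based; apply: WH; split; first exact: models_variety.
move=> T BT; apply: birkhoff => // -[p q] We; apply: BT.
by split; apply: (bipartite_of_identity SA nSK) => // v; rewrite (We S WS).
Qed.

(** * The hereditarily finitely based subvarieties *)

Lemma hfb_subvarieties_calK V : V `<=` calA -> calK `<=` V ->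
  hfb_subvarieties V = [set W | subvariety W calK].
Proof.
move=> VA KV; apply/seteqP; split=> W.
  move=> [[WV WsubV] WH]; split=> //.
  by apply: hereditarily_finitely_based_sub_calK => // S /WsubV/VA.
move=> [WV WK]; split; first by split=> // S /WK/KV.
by move=> U [UV UW]; apply: subvariety_K_finitely_based; split=> // S /UW/WK.
Qed.

Lemma calK_greatest V : V `<=` calA -> calK `<=` V ->
  is_greatest (hfb_subvarieties V) calK.
Proof.
move=> VA KV; rewrite (hfb_subvarieties_calK VA KV); split=> [|W []//].
by split; first exact: calK_variety.
Qed.

Theorem corollary5p2 :
  is_greatest (hfb_subvarieties calA) calK /\
  is_greatest (hfb_subvarieties calM) calK /\
  hfb_subvarieties calA = hfb_subvarieties calM /\
  finite_set (hfb_subvarieties calA).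
Proof.
have AA : calA `<=` calA by [].
have KA := calK_sub_calA; have KM := calK_sub_calM; have MA := calM_sub_calA.
split; first exact: calK_greatest.
split; first exact: calK_greatest.
rewrite (hfb_subvarieties_calK AA KA) (hfb_subvarieties_calK MA KM).
by split; last exact: finite_subvarieties_K.
Qed.
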